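(* Let $V\sim N(\mu,\Sigma)$ be a Gaussian random vector with positive definite covariance matrix $\Sigma$, and let $a\ne c$ and $z\notin\{a,c\}$ be components of $V$. Suppose that for some component $x$ of $V$, $a\perp\!\!\!\perp c\mid x$ and $\{a,c\}\perp\!\!\!\perp z\mid x$. Then $$\rho^2_{ac\mid z}\le\rho^2_{ac}.$$ If in addition $z'\notin\{a,c\}$ is a component of $V$ with $\{a,c\}\perp\!\!\!\perp z'\mid z$, then $$\rho^2_{ac\mid z}\le\rho^2_{ac\mid z'}\le\rho^2_{ac}.$$
   Context: $X\perp\!\!\!\perp Y\mid W$ denotes conditional independence of the (sub)vectors $X$ and $Y$ given $W$; for components of a Gaussian vector it is equivalent to $\Sigma_{XY}-\Sigma_{XW}\Sigma_{WW}^{-1}\Sigma_{WY}=0$ (this also makes sense if the sets overlap; in particular $x$ may coincide with one of the other components). For distinct components $u,v$ and a set $Z$ of components with $u,v\notin Z$, the squared partial correlation is $$\rho^2_{uv\mid Z}=\frac{(\sigma_{uv}-\Sigma_{uZ}\Sigma_{ZZ}^{-1}\Sigma_{Zv})^2}{(\sigma_{uu}-\Sigma_{uZ}\Sigma_{ZZ}^{-1}\Sigma_{Zu})(\sigma_{vv}-\Sigma_{vZ}\Sigma_{ZZ}^{-1}\Sigma_{Zv})},$$ where $\sigma_{uv}$ is the $(u,v)$ entry of $\Sigma$ and $\Sigma_{uZ}$ etc. are submatrices; $\rho^2_{uv}=\rho^2_{uv\mid\emptyset}=\sigma_{uv}^2/(\sigma_{uu}\sigma_{vv})$. *)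

(* Defs.v *)
From HB Require Import structures.
From mathcomp Require Import all_boot all_order all_algebra.
From mathcomp Require Import all_classical all_reals all_analysis.

Set Implicit Arguments.
Unset Strict Implicit.
Unset Printing Implicit Defensive.

Import Order.TTheory GRing.Theory Num.Theory.
Import numFieldNormedType.Exports.

Local Open Scope classical_set_scope.
Local Open Scope ring_scope.

Definition posdefmx (R : realType) (n : nat) (S : 'M[R]_n) : Prop :=
  S^T = S /\ forall t : 'rV[R]_n, t != 0 -> 0 < (t *m S *m t^T) 0 0.

(* V ~ N(mu, S) for S positive definite: every non-trivial linear combination
   t.V has the univariate law N(t.mu, t S t^T).  The second parameter of
   [normal_prob] is the standard deviation.  The case t = 0 must be left out
   because [normal_prob m 0] is the uniform law on [0, 1], not the Dirac mass
   at m; for the same reason the definition is meant for positive definite S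
   only. *)
Definition gaussian_vector (R : realType) (d : measure_display)
    (T : measurableType d) (P : probability T R) (n : nat)
    (V : 'I_n -> {RV P >-> R}) (mu : 'rV[R]_n) (S : 'M[R]_n) : Prop :=
  forall t : 'rV[R]_n, t != 0 ->
  forall B : set R, measurable B ->
    P ((fun w => \sum_(i < n) t 0 i * V i w) @^-1` B) =
    normal_prob (\sum_(i < n) t 0 i * mu 0 i)
                (Num.sqrt ((t *m S *m t^T) 0 0)) B.

(* The sigma-algebra on T generated by the subvector (V i)_(i in I). *)
Definition sigma_subvector (R : realType) (d : measure_display)
    (T : measurableType d) (P : probability T R) (n : nat)
    (V : 'I_n -> {RV P >-> R}) (I : {set 'I_n}) : set (set T) :=
  <<s \bigcup_(i in [set i | i \in I])
        preimage_set_system setT (V i) measurable >>.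

(* p is a version of the conditional probability P(E | G), for a
   sub-sigma-algebra G. *)
Definition cond_prob_version (R : realType) (d : measure_display)
    (T : measurableType d) (P : probability T R)
    (G : set (set T)) (E : set T) (p : T -> R) : Prop :=
  [/\ forall B : set R, measurable B -> G (p @^-1` B),
      P.-integrable setT (EFin \o p) &
      forall C : set T, G C ->
        (\int[P]_(w in C) (p w)%:E = P (E `&` C))%E].

(* (V i)_(i in I) and (V j)_(j in J) are conditionally independent given
   (V k)_(k in K):  P(E /\ F | V_K) = P(E | V_K) P(F | V_K) almost surely.
   Versions exist and are almost surely unique, so quantifying them
   existentially or universally is the same.  I, J and K may overlap. *)
Definition cond_indep (R : realType) (d : measure_display)
    (T : measurableType d) (P : probability T R) (n : nat)
    (V : 'I_n -> {RV P >-> R}) (I J K : {set 'I_n}) : Prop :=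
  forall E F : set T, sigma_subvector V I E -> sigma_subvector V J F ->
  exists p q r : T -> R,
    [/\ cond_prob_version P (sigma_subvector V K) E p,
        cond_prob_version P (sigma_subvector V K) F q,
        cond_prob_version P (sigma_subvector V K) (E `&` F) r &
        {ae P, forall w, r w = p w * q w}].

(* S_uv - S_uZ S_ZZ^-1 S_Zv, which is S_uv when Z is empty. *)
Definition partial_cov (R : realType) (n : nat) (S : 'M[R]_n)
    (u v : 'I_n) (Z : {set 'I_n}) : R :=
  let e : 'I_#|Z| -> 'I_n := enum_val in
  S u v - (colsub e (row u S) *m invmx (mxsub e e S)
             *m rowsub e (col v S)) 0 0.

Definition sq_partial_corr (R : realType) (n : nat) (S : 'M[R]_n)
    (u v : 'I_n) (Z : {set 'I_n}) : R :=
  partial_cov S u v Z ^+ 2 / (partial_cov S u u Z * partial_cov S v v Z).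

(* Main.v *)
(** A pair of uncorrelated linear combinations (N, Y) of the centered vector has
    the same one-dimensional projections as (-N, Y), so E[sin(s N) cos(t Y + c)]
    vanishes, and letting s tend to 0, E[N cos(t Y + c)] = 0 for all t and c.
    Bounded pointwise limits of trigonometric polynomials include the indicators
    of half-lines, hence E[N; Y in B] = 0 for every Borel set B: this replaces
    the Cramer-Wold theorem and uses first moments only.

    If V_u and V_v are conditionally independent given V_x, the residual
    U = V_u - (S_ux / S_xx) V_x (centered) satisfies E[U; V_v in B] = 0: with
    q = P(V_v in B | V_x), the variable 1_(V_v in B) - q is orthogonal to
    sigma(V_u) and sigma(V_x), while U is orthogonal to sigma(V_x).  Subtracting
    from U its regression on V_v then forces that regression to vanish, that is
    S_uv = S_ux S_xv / S_xx.

    With k = rho^2_xz, these identities give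
    rho^2_(ac|z) = rho^2_ac (1 - k)^2 / ((1 - rho^2_ax k) (1 - rho^2_cx k)),
    which decreases in k; passing from z to z' multiplies k by rho^2_zz' <= 1,
    and k = 0 gives rho^2_ac. *)

Require Import Defs.
From HB Require Import structures.
From mathcomp Require Import all_boot all_order all_algebra.
From mathcomp Require Import all_classical all_reals all_analysis.
From mathcomp Require Import measurable_realfun ring lra.

Set Implicit Arguments.
Unset Strict Implicit.
Unset Printing Implicit Defensive.

Import Order.TTheory GRing.Theory Num.Theory.
Import numFieldNormedType.Exports.

Local Open Scope ring_scope.

(** * Orthogonality of an integrable function to a class of events *)

Section orthogonality.
Local Open Scope classical_set_scope.
Context d (T : measurableType d) (R : realType).
Variable P : probability T R.
Implicit Types (D Y f h : T -> R) (G : set (set T)).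

(** For integrable [D] and a sub-sigma-algebra [G] this is E[D | G] = 0, expressed through integrals
    over events only. *)
Definition orth (D : T -> R) (G : set (set T)) :=
  forall C, G C -> (\int[P]_(w in C) (D w)%:E = 0)%E.

Definition sigma_rv (Y : T -> R) : set (set T) :=
  preimage_set_system setT Y measurable.

Lemma sigma_rv_preimage Y (B : set R) : measurable B -> sigma_rv Y (Y @^-1` B).
Proof. by move=> mB; exists B => //; rewrite setTI. Qed.

Lemma sigma_rv_measurable Y : measurable_fun setT Y ->
  forall C, sigma_rv Y C -> measurable C.
Proof. by move=> mY _ [B mB <-]; exact: mY. Qed.

Lemma bounded_integrable (h : T -> R) (M : R) :
  measurable_fun setT h -> (forall w, `|h w| <= M) ->
  P.-integrable setT (EFin \o h).
Proof.
move=> mh hM; apply: measurable_bounded_integrable => //.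
  by apply: le_lt_trans (probability_le1 P measurableT) _; rewrite ltry.
exists M; split => [|x Mx w _]; first exact: num_real.
exact: le_trans (hM w) (ltW Mx).
Qed.

Lemma integrable_mul_bounded (D h : T -> R) (M : R) :
  P.-integrable setT (EFin \o D) -> measurable_fun setT h ->
  (forall w, `|h w| <= M) ->
  P.-integrable setT (EFin \o (fun w => D w * h w)).
Proof.
move=> iD mh hM; have := @integrableMl _ _ _ P _ measurableT _ h iD mh.
apply; exists M; split => [|x Mx w _]; first exact: num_real.
exact: le_trans (hM w) (ltW Mx).
Qed.

Lemma integrable_measurable D :
  P.-integrable setT (EFin \o D) -> measurable_fun setT D.
Proof. by move=> /measurable_int/measurable_EFinP. Qed.

Lemma Rintegral_eq0 C D : (\int[P]_(w in C) (D w)%:E = 0)%E ->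
  \int[P]_(w in C) D w = 0.
Proof. by move=> h; rewrite /Rintegral h. Qed.

Lemma integral_Rintegral C D : measurable C ->
  P.-integrable setT (EFin \o D) ->
  (\int[P]_(w in C) (D w)%:E = (\int[P]_(w in C) D w)%:E)%E.
Proof.
move=> mC iD; rewrite /Rintegral fineK//.
apply: (integrable_fin_num _ (f := EFin \o D)) => //.
exact: (integrableS measurableT).
Qed.

Lemma orthP D G : P.-integrable setT (EFin \o D) ->
  (forall C, G C -> measurable C) ->
  orth D G <-> forall C, G C -> \int[P]_(w in C) D w = 0.
Proof.
move=> iD mG; split=> h C GC; first exact/Rintegral_eq0/h.
by rewrite integral_Rintegral ?h//; exact: mG.
Qed.

Lemma integrable_lincomb D1 D2 a b : P.-integrable setT (EFin \o D1) ->
  P.-integrable setT (EFin \o D2) ->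
  P.-integrable setT (EFin \o (fun w => a * D1 w + b * D2 w)).
Proof.
move=> i1 i2; exact: (integrableD measurableT (integrableZl measurableT a i1)
  (integrableZl measurableT b i2)).
Qed.

Lemma orthD D1 D2 G a b : P.-integrable setT (EFin \o D1) ->
  P.-integrable setT (EFin \o D2) -> (forall C, G C -> measurable C) ->
  orth D1 G -> orth D2 G -> orth (fun w => a * D1 w + b * D2 w) G.
Proof.
move=> i1 i2 mG o1 o2.
have i1a := integrableZl measurableT a i1.
have i2b := integrableZl measurableT b i2.
apply/orthP => //; first exact: integrable_lincomb.
move=> C GC; have mC := mG C GC.
have S (f : T -> R) : P.-integrable setT (EFin \o f) ->
    P.-integrable C (EFin \o f) by exact: integrableS.
rewrite (RintegralD mC (S _ i1a) (S _ i2b)).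
rewrite (RintegralZl _ mC (S _ i1)) (RintegralZl _ mC (S _ i2)).
by rewrite !Rintegral_eq0 ?mulr0 ?addr0//; [exact: o2|exact: o1].
Qed.

Lemma Rintegral_indicM C D : measurable C ->
  \int[P]_w (D w * \1_C w) = \int[P]_(w in C) D w.
Proof.
move=> mC; rewrite [RHS]Rintegral_mkcond; apply: eq_Rintegral => w _.
by rewrite patchE indicE; case: ifP => wC; rewrite ?mulr1 ?mulr0.
Qed.

(** Dominated convergence, in the shape in which every vanishing integral below is passed to a
    limit. *)
Lemma Rintegral_cvg0 (f_ : nat -> T -> R) f (g : T -> R) :
  (forall n, measurable_fun setT (f_ n)) ->
  (forall w, f_ ^~ w @ \oo --> f w) ->
  P.-integrable setT (EFin \o g) ->
  (forall n w, `|f_ n w| <= g w) ->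
  (forall n, \int[P]_w f_ n w = 0) -> \int[P]_w f w = 0.
Proof.
move=> mf_ f_f ig fg f0.
have mf : measurable_fun setT f.
  by apply: (measurable_fun_cvg (h := f_)) => // w _; exact: f_f.
have [|||||intf _ cvgf] := @dominated_convergence _ T R P setT measurableT
  (fun n w => (f_ n w)%:E) (EFin \o f) (EFin \o g).
- by move=> n; exact/measurable_EFinP.
- exact/measurable_EFinP.
- by apply/aeW => w _; apply: cvg_EFin; [exact: nearW|exact: f_f].
- exact: ig.
- by apply/aeW => w n _; rewrite lee_fin.
have h : (fun n => \int[P]_w f_ n w) @ \oo --> \int[P]_w f w.
  apply: fine_cvg; rewrite /Rintegral fineK//.
  exact: (integrable_fin_num _ (f := EFin \o f)).
have e : (fun n => \int[P]_w f_ n w) = cst 0 by apply/funext.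
rewrite e in h; rewrite -(cvg_lim (@Rhausdorff R) h).
exact: (cvg_lim (@Rhausdorff R) (cvg_cst _)).
Qed.

Import HBNNSimple.

(** Simple functions increase to [k]. For a simple function the integral is a finite combination of
    integrals of [D] over level sets, which are events of [G]; the limit is dominated by
    [|D * k(Y)|]. *)
Lemma orth_mul_nneg D Y G (k : R -> R) : P.-integrable setT (EFin \o D) ->
  (forall C, G C -> measurable C) ->
  orth D G -> (forall B, measurable B -> G (Y @^-1` B)) ->
  measurable_fun setT k -> (forall y, 0 <= k y) ->
  P.-integrable setT (EFin \o (fun w => D w * k (Y w))) ->
  \int[P]_w (D w * k (Y w)) = 0.
Proof.
move=> iD mG oD GY mk k0 iDk.
have mY : measurable_fun setT Y by move=> _ B mB; rewrite setTI; exact/mG/GY.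
have mD := integrable_measurable iD.
have mK : measurable_fun setT (EFin \o k) by exact/measurable_EFinP.
have K0 : forall y, [set: R] y -> (0 <= (EFin \o k) y)%E.
  by move=> y _; rewrite lee_fin.
pose g := nnsfun_approx measurableT mK.
have gk n y : 0 <= g n y <= k y.
  rewrite fun_ge0 /= /g nnsfun_approxE -lee_fin.
  exact: (le_approx (f := EFin \o k)).
have mgY n : measurable_fun setT (fun w => g n (Y w)).
  exact: (measurableT_comp (f := g n)).
apply: (Rintegral_cvg0 (f_ := fun n w => D w * g n (Y w))
    (g := fun w => `|D w * k (Y w)|)).
- by move=> n; exact: measurable_funM.
- move=> w; apply: cvgM; first exact: cvg_cst.
  have := fine_cvg (cvg_nnsfun_approx measurableT mK K0 (x := Y w) I).
  exact.
- exact: integrable_norm.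
- move=> n w; have /andP[g0 gle] := gk n (Y w).
  rewrite !normrM ler_wpM2l// (ger0_norm g0).
  by apply: le_trans gle _; exact: ler_norm.
- move=> n.
  have mpre v : measurable (Y @^-1` (g n @^-1` [set v])).
    exact/mG/GY.
  have G0 v : \int[P]_w (D w * \1_(Y @^-1` (g n @^-1` [set v])) w) = 0.
    by rewrite Rintegral_indicM//; exact/Rintegral_eq0/oD/GY.
  have iv v : P.-integrable setT
      (EFin \o (fun w => D w * \1_(Y @^-1` (g n @^-1` [set v])) w)).
    apply: (integrable_mul_bounded (M := 1)) => // w.
    by rewrite indicE ger0_norm ?ler0n// lern1 leq_b1.
  have e w : D w * g n (Y w) = \sum_(v <- finmap.enum_fset (fset_set (range (g n))))
      v * (D w * \1_(Y @^-1` (g n @^-1` [set v])) w).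
    rewrite (fimfunE (g n)) fsbig_finite//= mulr_sumr.
    by apply: eq_bigr => v _; rewrite mulrCA; congr (_ * (_ * _)).
  under eq_Rintegral do rewrite e.
  rewrite /Rintegral.
  under eq_integral do rewrite -sumEFin.
  have ivv v : P.-integrable setT
      (fun w => (v * (D w * \1_(Y @^-1` (g n @^-1` [set v])) w))%:E).
    exact: (integrableZl measurableT v (iv v)).
  rewrite integral_sum// big1// => v _.
  rewrite (integral_Rintegral measurableT (ivv v)).
  by rewrite (RintegralZl v measurableT (iv v)) G0 mulr0.
Qed.

(** [Y] is half the difference of [|Y| + Y] and [|Y| - Y], two nonnegative functions of [Y] whose
    products with [D] are dominated by [2 |D Y|]. *)
Lemma orth_mul D Y G : P.-integrable setT (EFin \o D) ->
  (forall C, G C -> measurable C) ->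
  orth D G -> (forall B, measurable B -> G (Y @^-1` B)) ->
  P.-integrable setT (EFin \o (fun w => D w * Y w)) ->
  \int[P]_w (D w * Y w) = 0.
Proof.
move=> iD mG oD GY iDY.
have mY : measurable_fun setT Y by move=> _ B mB; rewrite setTI; exact/mG/GY.
have mD := integrable_measurable iD.
have ynorm (y : R) : - `|y| <= y <= `|y| by rewrite -ler_norml.
have part (e : R) : `|e| = 1 ->
    P.-integrable setT (EFin \o (fun w => D w * (`|Y w| + e * Y w))) /\
    \int[P]_w (D w * (`|Y w| + e * Y w)) = 0.
  move=> e1; pose k (y : R) := `|y| + e * y.
  have mk : measurable_fun setT k.
    by apply: measurable_funD => //; exact: measurable_funM.
  have k0 y : 0 <= k y.
    by have /andP[] := ynorm (e * y); rewrite normrM e1 mul1r /k; lra.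
  have iDk : P.-integrable setT (EFin \o (fun w => D w * k (Y w))).
    have i2 := integrableZl measurableT 2 (integrable_norm iDY).
    apply: (le_integrable measurableT _ _ i2).
      apply/measurable_EFinP/measurable_funM => //.
      exact: (measurableT_comp (f := k)).
    move=> w _ /=; rewrite lee_fin !normrM normr_id mulrCA ler_wpM2l//.
    rewrite normr_id (ger0_norm (k0 _)) ger0_norm//.
    by have /andP[] := ynorm (e * Y w); rewrite normrM e1 mul1r /k; lra.
  by split => //; exact: orth_mul_nneg iD mG oD GY mk k0 iDk.
have [ip p0] := part 1 (normr1 _).
have [im m0] := part (-1) (normrN1 _).
have -> : \int[P]_w (D w * Y w) = \int[P]_w
    (2^-1 * (D w * (`|Y w| + 1 * Y w) - D w * (`|Y w| + -1 * Y w))).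
  by apply: eq_Rintegral => w _; field.
rewrite RintegralZl//.
  by rewrite RintegralB// p0 m0 subrr mulr0.
exact: (integrableB measurableT ip im).
Qed.

(** A vanishing integral of [|D|] makes [D] zero almost everywhere on [C]; as [D] is positive there,
    [C] lies inside the exceptional null set. *)
Lemma integral_eq0_null C D : measurable C -> P.-integrable setT (EFin \o D) ->
  (forall w, C w -> 0 < D w) -> (\int[P]_(w in C) (D w)%:E = 0)%E -> P C = 0%E.
Proof.
move=> mC iD D0 I0.
have mD : measurable_fun C (EFin \o D).
  by apply/measurable_funTS/measurable_EFinP; exact: integrable_measurable.
have I00 : (\int[P]_(w in C) `|(EFin \o D) w| = 0)%E.
  rewrite -I0; apply: eq_integral => w /set_mem Cw /=.
  by rewrite ger0_norm// ltW// D0.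
have [N [mN N0 sub]] := (ae_eq_integral_abs P mC mD).1 I00.
apply: (subset_measure0 mC mN _ N0) => w Cw; apply: sub => /= /(_ Cw) [] Dw.
by have := D0 _ Cw; rewrite Dw ltxx.
Qed.

End orthogonality.

(** * Trigonometric polynomials converging to the sign of a sine *)

Section trigonometric_polynomials.
Local Open Scope classical_set_scope.
Context (R : realType).
Implicit Types (h k : R -> R) (r s t x : R).

(** The phase [s] makes cosines suffice: sines have phase - pi / 2 and constants have frequency
    0. *)
Inductive trigpoly : (R -> R) -> Prop :=
| trigpoly_cos t s : trigpoly (fun x => cos (t * x + s))
| trigpolyD h k : trigpoly h -> trigpoly k -> trigpoly (fun x => h x + k x)
| trigpolyZ c h : trigpoly h -> trigpoly (fun x => c * h x).

(** By bilinearity it is enough to multiply two cosines, where cos u cos v = (cos (u + v) + cos (u -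
    v)) / 2. *)
Lemma trigpolyM h k : trigpoly h -> trigpoly k ->
  trigpoly (fun x => h x * k x).
Proof.
have ext f g : f =1 g -> trigpoly f -> trigpoly g by move=> /funext ->.
move=> th; elim: th k => {h} [t s k tk|h1 h2 _ IH1 _ IH2 k tk|c h _ IH k tk].
- elim: tk => {k} [t' s'|k1 k2 _ IH1 _ IH2|c k _ IH].
  + apply: ext (trigpolyZ 2^-1 (trigpolyD
      (trigpoly_cos (t + t') (s + s')) (trigpoly_cos (t - t') (s - s')))) => x.
    have -> : (t + t') * x + (s + s') = (t * x + s) + (t' * x + s') by ring.
    have -> : (t - t') * x + (s - s') = (t * x + s) - (t' * x + s') by ring.
    by rewrite cosD cosB; field.
  + by apply: ext (trigpolyD IH1 IH2) => x; rewrite mulrDr.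
  + by apply: ext (trigpolyZ c IH) => x; rewrite mulrCA.
- by apply: ext (trigpolyD (IH1 k tk) (IH2 k tk)) => x; rewrite mulrDl.
- by apply: ext (trigpolyZ c (IH k tk)) => x; rewrite mulrA.
Qed.

(* The iterates of [s |-> (3 s - s^3) / 2] on [-1, 1] converge to the sign of
   [s]. *)
Definition sharpen (s : R) : R := (3 * s - s ^+ 3) / 2.

Definition square_wave t r n x : R := iter n sharpen (sin (t * (x - r))).

Lemma trigpoly_square_wave t r n : trigpoly (square_wave t r n).
Proof.
rewrite /square_wave; elim: n => [|n IH] /=.
  have -> : (fun x => sin (t * (x - r))) =
      (fun x => cos (t * x + (- (t * r) - pi / 2))).
    by apply/funext => x; rewrite addrA cosBpihalf; congr sin; ring.
  exact: trigpoly_cos.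
rewrite [X in trigpoly X](_ : _ = (fun x =>
    (3 / 2) * square_wave t r n x + (- 2^-1) *
    (square_wave t r n x * (square_wave t r n x * square_wave t r n x)))).
  apply: trigpolyD; first exact: trigpolyZ.
  by apply: trigpolyZ; apply: trigpolyM => //; exact: trigpolyM.
by apply/funext => x; rewrite /square_wave /sharpen; field.
Qed.

Lemma iter_sharpenN n s : iter n sharpen (- s) = - iter n sharpen s.
Proof. by elim: n => //= n ->; rewrite /sharpen; field. Qed.

(** The iterates stay above [s], so each application of [sharpen] multiplies the distance to the
    fixed point 1 by at most 1 - s / 2. *)
Lemma iter_sharpen_bounds n s : 0 < s <= 1 ->
  s <= iter n sharpen s <= 1 /\ 1 - iter n sharpen s <= (1 - s / 2) ^+ n.
Proof.
move=> /andP[s0 s1]; elim: n => [|n [/andP[sn n1] IH]] /=.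
  by rewrite expr0 lexx s1; split => //; lra.
set u := iter n sharpen s in sn n1 IH *.
(* The last factor is at most 1 - u / 2, hence at most 1 - s / 2. *)
have e : 1 - sharpen u = (1 - u) * (1 - (u + u ^+ 2) / 2).
  by rewrite /sharpen; field.
have u2 : u ^+ 2 <= u by rewrite expr2 ler_piMr//; lra.
have u20 : 0 <= u ^+ 2 by exact: sqr_ge0.
split; first apply/andP; first split.
- apply: le_trans sn _.
  have -> : sharpen u = u + u * (1 - u ^+ 2) / 2 by rewrite /sharpen; field.
  by rewrite lerDl divr_ge0// mulr_ge0//; lra.
- by rewrite -subr_ge0 e mulr_ge0//; lra.
- rewrite e (exprSr _ n) ler_pM//; lra.
Qed.

Lemma iter_sharpen_cvg s : 0 < s <= 1 ->
  (fun n => iter n sharpen s) @ \oo --> (1 : R).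
Proof.
move=> s01; have [s0 s1] := andP s01.
have g : (fun n => (1 - s / 2) ^+ n) @ \oo --> (0 : R).
  by apply: cvg_expr; rewrite ger0_norm; lra.
have lo : (fun n => 1 - (1 - s / 2) ^+ n) @ \oo --> (1 : R).
  by rewrite -[X in _ --> X]subr0; apply: cvgB => //; exact: cvg_cst.
apply: (squeeze_cvgr _ lo (cvg_cst (1 : R))).
apply: nearW => n; have [/andP[_ n1] n2] := iter_sharpen_bounds n s01.
by rewrite n1 andbT; lra.
Qed.

Lemma iter_sharpen_cvg_sgr s : -1 <= s <= 1 ->
  (fun n => iter n sharpen s) @ \oo --> Num.sg s.
Proof.
move=> /andP[sN1 s1]; have [s0|s0|->] := ltgtP s 0.
- rewrite ltr0_sg//.
  have -> : (fun n => iter n sharpen s) = (fun n => - iter n sharpen (- s)).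
    by apply/funext => n; rewrite iter_sharpenN opprK.
  by apply: cvgN; apply: iter_sharpen_cvg; lra.
- by rewrite gtr0_sg//; apply: iter_sharpen_cvg; lra.
- rewrite sgr0; have -> : (fun n => iter n sharpen 0) = cst 0.
    by apply/funext; elim=> //= n ->; rewrite /sharpen /cst/=; field.
  exact: cvg_cst.
Qed.

Lemma iter_sharpen_norm_le1 n s : -1 <= s <= 1 -> `|iter n sharpen s| <= 1.
Proof.
move=> /andP[sN1 s1]; have [s0|s0|->] := ltgtP s 0.
- rewrite -[s]opprK iter_sharpenN normrN.
  have /(iter_sharpen_bounds n)[/andP[a b] _] : 0 < - s <= 1 by lra.
  by rewrite ger0_norm//; lra.
- have /(iter_sharpen_bounds n)[/andP[a b] _] : 0 < s <= 1 by lra.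
  by rewrite ger0_norm//; lra.
- rewrite (_ : iter _ _ _ = 0) ?normr0//.
  by elim: n => //= n ->; rewrite /sharpen; field.
Qed.

End trigonometric_polynomials.

(** * Vanishing cosine moments imply orthogonality to the sigma-algebra of [X] *)

Section fourier_uniqueness.
Local Open Scope classical_set_scope.
Context d (T : measurableType d) (R : realType).
Variable P : probability T R.
Variables (D X : T -> R).
Hypothesis iD : P.-integrable setT (EFin \o D).
Hypothesis mX : measurable_fun setT X.
Hypothesis DX : forall t s : R, \int[P]_w (D w * cos (t * X w + s)) = 0.

(** The bound [M] is an explicit parameter because limits are taken along sequences that share one
    bound. *)
Definition annih (M : R) (h : R -> R) := [/\ measurable_fun setT h,
  forall x, `|h x| <= M & \int[P]_w (D w * h (X w)) = 0].

Lemma annih_integrable M h : annih M h ->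
  P.-integrable setT (EFin \o (fun w => D w * h (X w))).
Proof.
move=> [mh hM _]; apply: (integrable_mul_bounded (M := M)) => //.
exact: (measurableT_comp (f := h)).
Qed.

(** Sums and multiples accumulate crude constants; this restores a uniform bound before a limit is
    taken. *)
Lemma annih_bound M N h : annih M h -> (forall x, `|h x| <= N) -> annih N h.
Proof. by move=> [mh _ h0]. Qed.

Lemma annihD M N h k : annih M h -> annih N k ->
  annih (M + N) (fun x => h x + k x).
Proof.
move=> ah ak; have ih := annih_integrable ah; have ik := annih_integrable ak.
case: ah ak => [mh hM h0] [mk kN k0]; split.
- exact: measurable_funD.
- by move=> x; apply: le_trans (ler_normD _ _) _; exact: lerD.
- under eq_Rintegral do rewrite mulrDr.
  by rewrite RintegralD// h0 k0 addr0.
Qed.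

Lemma annihZ M c h : annih M h -> annih (`|c| * M) (fun x => c * h x).
Proof.
move=> ah; have ih := annih_integrable ah.
case: ah => [mh hM h0]; split.
- exact: measurable_funM.
- by move=> x; rewrite normrM ler_wpM2l.
- under eq_Rintegral do rewrite mulrCA.
  by rewrite RintegralZl// h0 mulr0.
Qed.

Lemma annih_cvg M (h_ : nat -> R -> R) h : (forall n, annih M (h_ n)) ->
  (forall x, h_ ^~ x @ \oo --> h x) -> annih M h.
Proof.
move=> ah hh.
have mh : measurable_fun setT h.
  apply: (measurable_fun_cvg (h := h_)) => [n|x _]; last exact: hh.
  by case: (ah n).
have hM x : `|h x| <= M.
  apply: (ler_cvg_to (cvg_norm (hh x)) (cvg_cst M)).
  by apply: nearW => n; case: (ah n).
split => //.
have iM : P.-integrable setT (EFin \o (fun w => D w * M)).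
  by apply: (integrable_mul_bounded (M := `|M|)).
apply: (Rintegral_cvg0 (f_ := fun n w => D w * h_ n (X w))
    (g := fun w => `|D w * M|)).
- move=> n; apply: measurable_funM; first exact: integrable_measurable iD.
  by apply: (measurableT_comp (f := h_ n)) => //; case: (ah n).
- by move=> w; apply: cvgM; [exact: cvg_cst|exact: hh].
- exact: integrable_norm.
- move=> n w; rewrite !normrM ler_wpM2l//.
  by have [_ /(_ (X w)) hn _] := ah n; apply: le_trans hn (ler_norm _).
- by move=> n; case: (ah n).
Qed.

Lemma annih_cos t s : annih 1 (fun x => cos (t * x + s)).
Proof.
split; [|by move=> x; exact: cos_max|exact: DX].
apply: (measurableT_comp (f := @cos R)).
  by apply: continuous_measurable_fun; exact: continuous_cos.
by apply: measurable_funD => //; exact: measurable_funM.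
Qed.

Lemma annih_trigpoly h : trigpoly h -> exists M, annih M h.
Proof.
elim=> {h} [t s|h k _ [M ah] _ [N ak]|c h _ [M ah]].
- by exists 1; exact: annih_cos.
- by exists (M + N); exact: annihD.
- by exists (`|c| * M); exact: annihZ.
Qed.

Lemma annih_sgr_sin t r : annih 1 (fun x => Num.sg (sin (t * (x - r)))).
Proof.
have sin1 (x : R) : -1 <= sin x <= 1 by rewrite sin_geN1 sin_le1.
apply: (annih_cvg (h_ := square_wave t r)) => [n|x].
  have [M aM] := annih_trigpoly (trigpoly_square_wave t r n).
  by apply: (annih_bound aM) => x; exact: iter_sharpen_norm_le1.
exact: iter_sharpen_cvg_sgr.
Qed.

(** For fixed [x], once the half-period pi (n + 1) exceeds [|x - r|], the sine of (x - r) / (n + 1)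
    has the sign of x - r. *)
Lemma annih_sgr r : annih 1 (fun x => Num.sg (x - r)).
Proof.
apply: (annih_cvg (h_ := fun n x => Num.sg (sin (n.+1%:R^-1 * (x - r))))).
  by move=> n; exact: annih_sgr_sin.
move=> x; apply: cvg_near_cst; have [->|xr] := eqVneq x r.
  by apply: nearW => n; rewrite subrr mulr0 sin0.
have p0 : 0 < `|x - r| by rewrite normr_gt0 subr_eq0.
have e0 : 0 < pi / `|x - r| by rewrite divr_gt0// pi_gt0.
near=> n.
rewrite -[X in sin (_ * X)](mulr_sg_norm (x - r)) mulrCA sin_sg sgrM sgr_id.
rewrite [X in _ * X]gtr0_sg ?mulr1//.
apply: sin_gt0_pi; rewrite mulr_gt0//= -ltr_pdivlMr//.
by near: n; exact: (near_infty_natSinv_lt (PosNum e0)).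
Unshelve. all: by end_near. Qed.

(** The indicator is (step + 1) / 2, where the step takes the values -1 and 1. *)
Lemma annih_ray r : annih 1 \1_`[r, +oo[.
Proof.
have step : annih 1 (fun x => if r <= x then 1 else -1).
  (* The thresholds approach [r] from the left, so that the limit at [r] itself is 1 and not 0: the
     ray is closed. *)
  apply: (annih_cvg (h_ := fun n x => Num.sg (x - (r - n.+1%:R^-1)))).
    by move=> n; exact: annih_sgr.
  move=> x; apply: cvg_near_cst; case: (leP r x) => rx.
    by apply: nearW => n; rewrite gtr0_sg// subr_gt0; apply: lt_le_trans rx; rewrite gtrBl.
  have rx0 : 0 < r - x by rewrite subr_gt0.
  near=> n; rewrite ltr0_sg// subr_lt0 ltrBrDl -ltrBrDr.
  by near: n; exact: (near_infty_natSinv_lt (PosNum rx0)).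
have one := annih_cos 0 0.
apply: (annih_bound (M := `|2^-1| * (1 + 1))).
  have := annihZ 2^-1 (annihD step one); congr annih.
  apply/funext => x; rewrite mul0r addr0 cos0 indicE mem_setE in_itv/= andbT.
  by case: ifP => _ /=; field.
by move=> x; rewrite indicE ger0_norm// lern1 leq_b1.
Unshelve. all: by end_near. Qed.

(** Closed rays are stable under intersection and generate the Borel sets, and the sets [B] with
    E[D; X in B] = 0 form a Dynkin system. Complements use E[D] = 0, the cosine moment at t = s =
    0. *)
Lemma fourier_orth : orth P D (sigma_rv X).
Proof.
move=> _ [B mB <-]; rewrite setTI.
pose Q (B : set R) := (\int[P]_(w in X @^-1` B) (D w)%:E = 0)%E.
suff : Q B by [].
have mpre (A : set R) : measurable A -> measurable (X @^-1` A).
  by move=> mA; rewrite -[X in measurable X]setTI; exact: mX.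
have QE A : measurable A -> Q A <-> \int[P]_w (D w * \1_(X @^-1` A) w) = 0.
  move=> mA; rewrite /Q (Rintegral_indicM _ _ (mpre A mA)).
  by rewrite (integral_Rintegral (mpre A mA) iD); split => [[]|->].
have D0 : \int[P]_w D w = 0.
  by rewrite -[RHS](DX 0 0); apply: eq_Rintegral => w _;
    rewrite mul0r addr0 cos0 mulr1.
have mE := RGenCInfty.measurableE R.
apply: (@dynkin_induction _ _ (@RGenCInfty.G R) Q).
- exact: mE.
- move=> _ _ [r ->] [s ->]; exists (Num.max r s).
  apply/seteqP; split => x /=; rewrite !in_itv/= !andbT ge_max.
    by move=> [-> ->].
  by move=> /andP[].
- by apply/QE => //; rewrite -[RHS]D0; apply: eq_Rintegral => w _;
    rewrite preimage_setT indicT mulr1.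
- by move=> _ [r ->]; apply/QE => //; case: (annih_ray r).
- move=> A mA /(QE A mA) QA; apply/QE; first exact: measurableC.
  have iA : P.-integrable setT (EFin \o (fun w => D w * \1_(X @^-1` A) w)).
    apply: (integrable_mul_bounded (M := 1)) => //.
      by apply: measurable_indic; exact: mpre.
    by move=> w; rewrite indicE ger0_norm// lern1 leq_b1.
  rewrite -[RHS](subrr 0) -[X in X - _]D0 -[X in _ - X]QA -RintegralB//.
  apply: eq_Rintegral => w _; rewrite preimage_setC !indicE in_setC.
  by case: (w \in _); rewrite ?mulr1 ?mulr0 ?subr0 ?subrr.
- move=> F mF tF QF; rewrite /Q preimage_bigcup integral_bigcup.
  + by rewrite eseries0// => n _ _; exact: QF.
  + move=> i j _ _ [w [Fi Fj]]; apply: (tF i j I I).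
    by exists (X w).
  + by move=> k; exact: mpre.
  + apply: integrableS iD => //.
    by apply: bigcup_measurable => k _; exact: mpre.
- have : (@ocitv R).-sigma.-measurable B by [].
  by rewrite mE.
Qed.

End fourier_uniqueness.

(** * Integration against the univariate normal law *)

Section normal_law.
Local Open Scope classical_set_scope.
Context (R : realType).
Implicit Types (m s x y : R) (g : R -> R).
Local Notation leb := (@lebesgue_measure R).

(** The Radon-Nikodym derivative and [normal_pdf] have the same integral over every measurable set,
    so they agree almost everywhere. *)
Lemma ge0_integral_normal_prob m s (f : R -> \bar R) :
  measurable_fun setT f -> (forall x, 0 <= f x)%E ->
  (\int[normal_prob m s]_x f x = \int[leb]_x (f x * (normal_pdf m s x)%:E))%E.
Proof.
move=> mf f0; have dom := normal_prob_dominates m s.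
rewrite -(Radon_Nikodym_SigmaFinite.change_of_variables dom)//.
have mpdf : measurable_fun setT (EFin \o normal_pdf m s).
  by apply/measurable_EFinP; exact: measurable_normal_pdf.
have iRN := Radon_Nikodym_SigmaFinite.f_integrable dom.
apply: ae_eq_integral => //.
- by apply: emeasurable_funM => //; exact: measurable_int iRN.
- exact: emeasurable_funM.
- apply: ae_eqe_mul2l; apply: integral_ae_eq => //= E _ mE.
  by rewrite -Radon_Nikodym_SigmaFinite.f_integral.
Qed.

Lemma normal_pdf_shift m s x : s != 0 ->
  normal_pdf m s (x + m) = normal_pdf 0 s x.
Proof.
by move=> s0; rewrite !normal_pdfE// normal_fun_center /normal_fun/= !subr0 addrK.
Qed.

(** Substitution of x + m for x in the Lebesgue integral; with [g] nonnegative, both sides are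
    compared in the extended reals. *)
Lemma integral_normal_centered m s g : s != 0 -> continuous g ->
  (forall x, 0 <= g x) ->
  (\int[normal_prob m s]_x (g (x - m))%:E =
   \int[normal_prob 0 s]_x (g x)%:E)%E.
Proof.
move=> s0 cg g0.
have mg : measurable_fun setT g by exact: continuous_measurable_fun.
have D1 : (fun x => x + m)^`() = cst 1 :> (R -> R).
  apply/funext => x; rewrite derive1E deriveD// derive_id derive_cst addr0.
  by [].
rewrite !ge0_integral_normal_prob; first last.
- by move=> x; rewrite lee_fin.
- apply/measurable_EFinP/(measurableT_comp mg); exact: measurable_funB.
- by move=> x; rewrite lee_fin.
- exact/measurable_EFinP.
under eq_integral do rewrite -EFinM.
under [RHS]eq_integral do rewrite -EFinM.
rewrite (@increasing_ge0_integration_by_substitutionT _ (fun x => x + m)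
  (fun x => g (x - m) * normal_pdf m s x)).
- apply: eq_integral => x _; rewrite D1 !fctE/= mulr1 addrK.
  by rewrite normal_pdf_shift.
- by move=> x y xy; rewrite ltrD2r.
- by rewrite D1 => x; exact: cvg_cst.
- by rewrite D1; exact: is_cvg_cst.
- by rewrite D1; exact: is_cvg_cst.
- by move=> x.
- exact: cvg_addrr_Ny.
- exact: cvg_addrr.
- move=> x; apply: cvgM; last exact: continuous_normal_pdf.
  apply: (cvg_comp (fun x => x - m) g); last exact: cg.
  by apply: cvgB; [exact: cvg_id|exact: cvg_cst].
- by move=> x; rewrite mulr_ge0// normal_pdf_ge0.
Qed.

(* [2 u <= 1 + u^2 <= exp (u^2)] with [u = |x| / (2 s)] bounds [|x|] times the
   density of variance [s^2] by a multiple of the density of variance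
   [2 s^2]. *)
Lemma normr_normal_pdf_le s : 0 < s -> exists C, forall x,
  `|x| * normal_pdf 0 s x <= C * normal_pdf 0 (Num.sqrt 2 * s) x.
Proof.
move=> s0.
have r0 : 0 < Num.sqrt 2 * s by rewrite mulr_gt0// sqrtr_gt0.
exists (s * normal_peak s / normal_peak (Num.sqrt 2 * s)) => x.
rewrite !normal_pdfE ?gt_eqF//=.
have pk0 : 0 < normal_peak (Num.sqrt 2 * s) by rewrite normal_peak_gt0// gt_eqF.
set A := normal_peak s; set E1 := normal_fun 0 s x.
set B := normal_peak _ in pk0 *; set E2 := normal_fun 0 _ x.
rewrite [leRHS]mulrA divfK ?gt_eqF// -[leRHS]mulrA (mulrCA s) (mulrCA `|x|).
rewrite ler_wpM2l ?normal_peak_ge0//.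
have sn : s != 0 by rewrite gt_eqF.
have -> : E1 = E2 * expR (- (x / (2 * s)) ^+ 2).
  rewrite /E1 /E2 /normal_fun subr0 exprMn sqr_sqrtr// -expRD; congr expR.
  by field.
rewrite mulrCA (mulrC s) ler_wpM2l ?expR_ge0// expRN ler_pdivrMr ?expR_gt0//.
apply: (@le_trans _ _ (s * (1 + (x / (2 * s)) ^+ 2))); last first.
  by rewrite ler_wpM2l ?expR_ge1Dx// ltW.
rewrite -subr_ge0 -[(x / _) ^+ 2]real_normK ?num_real//.
rewrite normf_div (gtr0_norm (_ : 0 < 2 * s)) ?mulr_gt0//.
have -> : s * (1 + (`|x| / (2 * s)) ^+ 2) - `|x| =
    s * (1 - `|x| / (2 * s)) ^+ 2 by field.
by rewrite mulr_ge0 ?sqr_ge0// ltW.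
Qed.

(** After centering, the integrand is dominated by a multiple of a wider normal density. *)
Lemma integral_normr_normal_prob m s : 0 < s ->
  (\int[normal_prob m s]_x (`|x - m|)%:E < +oo)%E.
Proof.
move=> s0; have s0' : s != 0 by rewrite gt_eqF.
rewrite (integral_normal_centered m s0' (g := Num.norm))//; last first.
  by move=> x; exact: norm_continuous.
rewrite ge0_integral_normal_prob//; last exact/measurable_EFinP.
have [C hC] := normr_normal_pdf_le s0.
have /(integrableZl measurableT C)/integrableP[mC] :=
  integrable_normal_pdf 0 (Num.sqrt 2 * s).
apply: le_lt_trans; apply: ge0_le_integral => //.
- by move=> x _; rewrite lee_fin mulr_ge0// normal_pdf_ge0.
- apply: emeasurable_funM; first exact/measurable_EFinP.
  by apply/measurable_EFinP; exact: measurable_normal_pdf.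
- exact: measurableT_comp.
- by move=> x _; rewrite lee_fin; apply: le_trans (hC x) (ler_norm _).
Qed.

Lemma normal_prob_set1 m s x : normal_prob m s [set x] = 0%E.
Proof.
have /null_content_dominatesP := normal_prob_dominates m s.
by apply => //; exact: lebesgue_measure_set1.
Qed.

End normal_law.

(** * The sine near zero *)

Section sine_near_zero.
Local Open Scope classical_set_scope.
Context (R : realType).
Implicit Types (x y : R).

Lemma sin_mvt y : exists2 c, `|c| <= `|y| & sin y = cos c * y.
Proof.
have pos (z : R) : 0 <= z -> exists2 c, `|c| <= `|z| & sin z = cos c * z.
  move=> z0; have [|c] := @MVT_segment R sin cos 0 z z0 (fun x _ => is_derive_sin x).
    exact/continuous_subspaceT/continuous_sin.
  rewrite sin0 !subr0 in_itv/= => /andP[c0 cz] e; exists c => //.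
  by rewrite !ger0_norm.
have [/pos//|y0] := leP 0 y.
have [|c cy e] := pos (- y); first by rewrite oppr_ge0 ltW.
exists c; first by rewrite -(normrN y).
by apply: oppr_inj; rewrite -sinN e mulrN.
Qed.

Lemma norm_sin_le y : `|sin y| <= `|y|.
Proof.
have [c _ ->] := sin_mvt y.
by rewrite normrM ler_piMl// cos_max.
Qed.

(** The mean value theorem turns the sequence into cos (c n) * y with c n tending to 0. *)
Lemma cvg_sin_scaled y :
  (fun n => n.+1%:R * sin (n.+1%:R^-1 * y)) @ \oo --> y.
Proof.
have /choice[c hc] : forall n : nat, exists c,
    `|c| <= n.+1%:R^-1 * `|y| /\ sin (n.+1%:R^-1 * y) = cos c * (n.+1%:R^-1 * y).
  move=> n; have [c cle e] := sin_mvt (n.+1%:R^-1 * y).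
  by exists c; split => //; apply: le_trans cle _; rewrite normrM ger0_norm.
have inv0 : (fun n => n.+1%:R^-1 * `|y|) @ \oo --> (0 : R).
  by rewrite -[X in _ --> X](mul0r `|y|); apply: cvgM; [exact: cvg_harmonic|exact: cvg_cst].
have c0 : c @ \oo --> (0 : R).
  apply/norm_cvg0P.
  apply: (squeeze_cvgr _ (cvg_cst (0 : R)) inv0).
  by apply: nearW => n; have [-> _] := hc n; rewrite normr_ge0.
have -> : (fun n => n.+1%:R * sin (n.+1%:R^-1 * y)) = (fun n => cos (c n) * y).
  by apply/funext => n; have [_ ->] := hc n; rewrite mulrCA mulVKf.
rewrite -[X in _ --> X]mul1r -cos0; apply: cvgM; last exact: cvg_cst.
by apply: (cvg_comp c cos c0); exact: continuous_cos.
Qed.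

End sine_near_zero.

(** * Linear combinations of a Gaussian vector *)

Section gaussian.
Local Open Scope classical_set_scope.
Context (R : realType) (d : measure_display) (T : measurableType d).
Context (P : probability T R) (n : nat) (V : 'I_n -> {RV P >-> R}).
Context (mu : 'rV[R]_n) (S : 'M[R]_n).
Hypothesis S_posdef : posdefmx S.
Hypothesis V_gaussian : gaussian_vector V mu S.
Implicit Types (l m : 'rV[R]_n).

(** A coefficient row stands for a linear combination of the components of [V]; this is the
    covariance of two of them. *)
Definition cov l m : R := (l *m S *m m^T) 0 0.

Definition centered l (w : T) : R := \sum_(i < n) l 0 i * (V i w - mu 0 i).

Lemma covC l m : cov l m = cov m l.
Proof.
have [sS _] := S_posdef.
rewrite /cov -[RHS](_ : (m *m S *m l^T)^T 0 0 = _); last by rewrite mxE.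
by rewrite !trmx_mul trmxK sS mulmxA.
Qed.

Lemma covDl a b l1 l2 m : cov (a *: l1 + b *: l2) m = a * cov l1 m + b * cov l2 m.
Proof. by rewrite /cov !mulmxDl -!scalemxAl !mxE. Qed.

Lemma covDr a b l m1 m2 : cov l (a *: m1 + b *: m2) = a * cov l m1 + b * cov l m2.
Proof. by rewrite covC covDl !(covC l). Qed.

Lemma cov0 l : cov l 0 = 0.
Proof. by rewrite /cov trmx0 mulmx0 mxE. Qed.

Lemma cov_delta i j : cov (delta_mx 0 i) (delta_mx 0 j) = S i j.
Proof. by rewrite /cov -rowE trmx_delta -colE !mxE. Qed.

Lemma cov_gt0 l : l != 0 -> 0 < cov l l.
Proof. by have [_] := S_posdef; apply. Qed.

Lemma centeredD a b l m w :
  centered (a *: l + b *: m) w = a * centered l w + b * centered m w.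
Proof.
rewrite /centered !mulr_sumr -big_split; apply: eq_bigr => i _ /=.
by rewrite !mxE; ring.
Qed.

Lemma centered0 w : centered 0 w = 0.
Proof. by rewrite /centered big1// => i _; rewrite mxE mul0r. Qed.

Lemma centered_delta i w : centered (delta_mx 0 i) w = V i w - mu 0 i.
Proof.
rewrite /centered (bigD1 i)//= big1 ?mxE ?eqxx ?mul1r ?addr0// => j ji.
by rewrite mxE eqxx/= (negbTE ji) mul0r.
Qed.

Lemma measurable_centered l : measurable_fun setT (centered l).
Proof.
apply: measurable_sum => i; apply: measurable_funM => //.
exact: measurable_funB.
Qed.

(** [V_gaussian] identifies the distribution of l.V with a normal law on Borel sets, hence as an
    integrating measure; [centered l] is l.V minus its mean. *)
Lemma integral_gaussian l (g : R -> R) : l != 0 ->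
  measurable_fun setT g -> (forall x, 0 <= g x) ->
  (\int[P]_w (g (centered l w))%:E =
   \int[normal_prob (\sum_(i < n) l 0 i * mu 0 i) (Num.sqrt (cov l l))]_x
     (g (x - \sum_(i < n) l 0 i * mu 0 i))%:E)%E.
Proof.
move=> l0 mg g0; set m := \sum_(i < n) _.
pose Y w := \sum_(i < n) l 0 i * V i w.
have mY : measurable_fun setT Y.
  by apply: measurable_sum => i; exact: measurable_funM.
have mgm : measurable_fun setT (fun x : R => (g (x - m))%:E).
  by apply/measurable_EFinP/(measurableT_comp mg); exact: measurable_funB.
pose Ym : {mfun T >-> measurableTypeR R} := 
  HB.pack Y (@isMeasurableFun.Build _ _ T (measurableTypeR R) Y mY).
transitivity (\int[distribution P Ym]_x (g (x - m))%:E)%E; last first.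
  by apply: eq_measure_integral => A mA _; exact: V_gaussian.
rewrite ge0_integral_distribution//; last by move=> x; rewrite lee_fin.
apply: eq_integral => w _ /=; congr (g _)%:E.
by rewrite /centered /Y /m -sumrB; apply: eq_bigr => i _; rewrite mulrBr.
Qed.

Lemma sqrt_cov_gt0 l : l != 0 -> 0 < Num.sqrt (cov l l).
Proof. by move=> l0; rewrite sqrtr_gt0 cov_gt0. Qed.

Lemma integrable_centered l : P.-integrable setT (EFin \o centered l).
Proof.
(* The zero combination is treated apart, since [gaussian_vector] speaks of nonzero ones only. *)
have [->|l0] := eqVneq l 0.
  rewrite (_ : EFin \o _ = cst 0%E); first exact: integrable0.
  by apply/funext => w /=; rewrite centered0.
apply/integrableP; split.
  by apply/measurable_EFinP; exact: measurable_centered.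
rewrite (integral_gaussian l0 (g := Num.norm))//.
exact/integral_normr_normal_prob/sqrt_cov_gt0.
Qed.

(** Centered combinations of equal variance have the same law. Adding 1 makes the sine nonnegative,
    as the integral formulas for normal laws require. *)
Lemma Rintegral_sin_centered l1 l2 s : l1 != 0 -> l2 != 0 ->
  cov l1 l1 = cov l2 l2 ->
  \int[P]_w sin (centered l1 w + s) = \int[P]_w sin (centered l2 w + s).
Proof.
move=> l10 l20 cov12.
have csin : continuous (fun x : R => sin (x + s)).
  move=> x; apply: (cvg_comp (fun x => x + s) sin); last exact: continuous_sin.
  by apply: cvgD; [exact: cvg_id|exact: cvg_cst].
have cg : continuous (fun x : R => 1 + sin (x + s)).
  by move=> x; apply: cvgD; [exact: cvg_cst|exact: csin].
have g0 x : 0 <= 1 + sin (x + s) by rewrite -lerBlDl sub0r sin_geN1.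
have mg := continuous_measurable_fun cg.
have E l : \int[P]_w sin (centered l w + s) =
    \int[P]_w (1 + sin (centered l w + s)) - \int[P]_w 1.
  rewrite RintegralD//.
  - by rewrite addrC addKr.
  - by apply: (bounded_integrable P (M := 1)) => // w; rewrite normr1.
  - apply: (bounded_integrable P (M := 1)) => [|w]; last exact: sin_max.
    apply: (measurableT_comp (continuous_measurable_fun csin)).
    exact: measurable_centered.
rewrite !E; congr (_ - _).
have I l : l != 0 -> cov l l = cov l2 l2 ->
    (\int[P]_w (1 + sin (centered l w + s))%:E =
     \int[normal_prob 0 (Num.sqrt (cov l2 l2))]_x (1 + sin (x + s))%:E)%E.
  move=> l0 <-; rewrite (integral_gaussian l0 mg g0).
  by rewrite (integral_normal_centered _ _ cg g0)// gt_eqF// sqrt_cov_gt0.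
by rewrite /Rintegral (I l1 l10 cov12) (I l2 l20 erefl).
Qed.

(* Since [cov l m = 0], the combinations [s l + t m] and [- s l + t m] have the
   same variance, hence the same law. *)
Lemma Rintegral_sin_cos_centered l m s t c : cov l m = 0 ->
  \int[P]_w (sin (s * centered l w) * cos (t * centered m w + c)) = 0.
Proof.
move=> lm0.
have [->|s0] := eqVneq s 0.
  transitivity (\int[P]_w (0 : R)); last by rewrite Rintegral_cst// mul0r.
  by apply: eq_Rintegral => w _; rewrite mul0r sin0 mul0r.
have [->|l0] := eqVneq l 0.
  transitivity (\int[P]_w (0 : R)); last by rewrite Rintegral_cst// mul0r.
  by apply: eq_Rintegral => w _; rewrite centered0 mulr0 sin0 mul0r.
have sin_int k : P.-integrable setT (EFin \o (fun w => sin (centered k w + c))).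
  apply: (bounded_integrable P (M := 1)) => [|w]; last exact: sin_max.
  apply: (measurableT_comp (f := @sin R)).
    by apply: continuous_measurable_fun; exact: continuous_sin.
  by apply: measurable_funD => //; exact: measurable_centered.
(* The covariance of this combination with [l] is e times the variance of [l], which is not zero. *)
have nz (e : R) : e != 0 -> e *: l + t *: m != 0.
  move=> e0; apply/eqP => h; have := covDl e t l m l.
  rewrite h covC cov0 (covC m) lm0 mulr0 addr0 => /esym/eqP.
  by rewrite mulf_eq0 (negbTE e0) gt_eqF// cov_gt0.
(* 2 sin A cos B = sin (A + B) - sin (- A + B). *)
have -> : \int[P]_w (sin (s * centered l w) * cos (t * centered m w + c)) =
  \int[P]_w (2^-1 * (sin (centered (s *: l + t *: m) w + c) -
                     sin (centered ((- s) *: l + t *: m) w + c))).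
  apply: eq_Rintegral => w _; rewrite !centeredD -!addrA.
  by rewrite !(sinD (_ * centered l w)) mulNr sinN cosN; field.
rewrite RintegralZl//; last exact: (integrableB measurableT (sin_int _) (sin_int _)).
rewrite (RintegralB measurableT (sin_int _) (sin_int _)).
rewrite (Rintegral_sin_centered (l2 := (- s) *: l + t *: m)) ?nz ?oppr_eq0//.
  by rewrite subrr mulr0.
by rewrite !(covDl, covDr) (covC m l) lm0; ring.
Qed.

(** The functions (n + 1) sin (Y / (n + 1)), with Y = [centered l], converge to Y and are dominated
    by [|Y|], so the vanishing sine-cosine moments pass to Y itself. *)
Lemma centered_orth l m : cov l m = 0 ->
  orth P (centered l) (sigma_rv (centered m)).
Proof.
move=> lm0; apply: fourier_orth.
- exact: integrable_centered.
- exact: measurable_centered.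
move=> t c.
have mcos : measurable_fun setT (fun w => cos (t * centered m w + c)).
  apply: (measurableT_comp (f := @cos R)).
    by apply: continuous_measurable_fun; exact: continuous_cos.
  by apply: measurable_funD => //; apply: measurable_funM => //; exact: measurable_centered.
apply: (Rintegral_cvg0 (f_ := fun n w => (n.+1%:R * sin (n.+1%:R^-1 * centered l w)) *
      cos (t * centered m w + c)) (g := fun w => `|centered l w|)).
- move=> k; apply: measurable_funM => //; apply: measurable_funM => //.
  apply: (measurableT_comp (f := @sin R)).
    by apply: continuous_measurable_fun; exact: continuous_sin.
  by apply: measurable_funM => //; exact: measurable_centered.
- by move=> w; apply: cvgM; [exact: cvg_sin_scaled|exact: cvg_cst].
- exact/integrable_norm/integrable_centered.
- move=> k w; rewrite normrM -[leRHS]mulr1 ler_pM ?cos_max//.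
  rewrite normrM ger0_norm// -ler_pdivlMl//; apply: le_trans (norm_sin_le _) _.
  by rewrite normrM ger0_norm.
- move=> k; under eq_Rintegral do rewrite -mulrA.
  rewrite RintegralZl//.
    by rewrite Rintegral_sin_cos_centered ?mulr0.
  apply: (bounded_integrable P (M := 1)).
    apply: measurable_funM => //.
    apply: (measurableT_comp (f := @sin R)).
      by apply: continuous_measurable_fun; exact: continuous_sin.
    by apply: measurable_funM => //; exact: measurable_centered.
  by move=> w; rewrite normrM mulr_ile1 ?sin_max ?cos_max.
Qed.

End gaussian.

(** * Conditional probabilities and conditionally independent events *)

Section conditional_independence.
Local Open Scope classical_set_scope.
Context (R : realType) (d : measure_display) (T : measurableType d).
Context (P : probability T R).
Implicit Types (G : set (set T)) (E F : set T) (p q r : T -> R).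

Lemma integrable_indic_prob F : measurable F ->
  P.-integrable setT (EFin \o (\1_F : T -> R)).
Proof.
move=> mF; apply: (bounded_integrable P (M := 1)) => // w.
by rewrite indicE ger0_norm// lern1 leq_b1.
Qed.

(** The difference is written with coefficients 1 and -1 to fit [integrable_lincomb] and [orthD]. *)
Lemma cond_prob_orth G F q : (forall C, G C -> measurable C) ->
  measurable F -> cond_prob_version P G F q ->
  orth P (fun w => 1 * \1_F w + -1 * q w) G.
Proof.
move=> mG mF [Gq iq qF]; have iF := integrable_indic_prob mF.
have i1 := integrableZl measurableT 1 iF.
have i2 := integrableZl measurableT (-1) iq.
apply/orthP => //; first exact: integrable_lincomb.
move=> C GC; have mC := mG C GC.
have S (f : T -> R) : P.-integrable setT (EFin \o f) ->
    P.-integrable C (EFin \o f) by exact: integrableS.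
rewrite (RintegralD mC (S _ i1) (S _ i2)).
rewrite (RintegralZl _ mC (S _ iF)) (RintegralZl _ mC (S _ iq)).
rewrite {2}/Rintegral qF// /Rintegral integral_indic//.
by rewrite mul1r mulN1r subrr.
Qed.

(** A version is only integrable; clamping it to [0, 1] makes its products integrable. The events q
    < 0 and q > 1 lie in [G], and the indicator of [F] minus [q] has a strict sign on each but
    integral zero, so both are null. *)
Lemma cond_prob_truncate G F q : (forall C, G C -> measurable C) ->
  measurable F -> cond_prob_version P G F q ->
  exists q', [/\ forall B, measurable B -> G (q' @^-1` B),
    forall w, `|q' w| <= 1, {ae P, forall w, q w = q' w} &
    orth P (fun w => 1 * \1_F w + -1 * q' w) G].
Proof.
move=> mG mF vq; have oq := cond_prob_orth mG mF vq.
have [Gq iq _] := vq; have iF := integrable_indic_prob mF.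
have mq := integrable_measurable iq.
pose tr (y : R) := Num.min (Num.max y 0) 1.
have mtr : measurable_fun setT tr.
  by apply: measurable_minr => //; exact: measurable_maxr.
have trE y : 0 <= y <= 1 -> tr y = y.
  by move=> /andP[y0 y1]; rewrite /tr max_l// min_l.
have tr01 y : 0 <= tr y <= 1.
  by rewrite /tr le_min ge_min lexx orbT le_max lexx orbT ler01.
pose q' w := tr (q w).
have Gq' B : measurable B -> G (q' @^-1` B).
  move=> mB; apply: (Gq (tr @^-1` B)).
  by rewrite -[X in measurable X]setTI; exact: mtr.
have mq' : measurable_fun setT q'.
  by move=> _ B mB; rewrite setTI; apply: mG; exact: Gq'.
have q'1 w : `|q' w| <= 1 by have /andP[q0 q1] := tr01 (q w); rewrite ger0_norm.
have iq' := bounded_integrable P mq' q'1.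
have id := integrable_lincomb 1 (-1) iF iq.
have id' := integrable_lincomb 1 (-1) iF iq'.
have indic01 w : 0 <= (\1_F w : R) <= 1 by rewrite indicE ler0n lern1 leq_b1.
have neg0 : P (q @^-1` `]-oo, 0[) = 0%E.
  have Gneg : G (q @^-1` `]-oo, 0[) by exact: Gq.
  apply: (integral_eq0_null _ id _ (oq _ Gneg)); first exact: mG.
  move=> w /=; rewrite in_itv/= => qw.
  by have /andP[] := indic01 w; lra.
have big0 : P (q @^-1` `]1, +oo[) = 0%E.
  have Gbig : G (q @^-1` `]1, +oo[) by exact: Gq.
  (* Coefficients -1 and 0 give the negated difference, positive where q > 1. *)
  have oN := orthD (-1) 0 id id mG oq oq.
  apply: (integral_eq0_null _ _ _ (oN _ Gbig)); first exact: mG.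
    exact: integrable_lincomb.
  move=> w /=; rewrite in_itv/= andbT => qw.
  by have /andP[] := indic01 w; lra.
have qq' : {ae P, forall w, q w = q' w}.
  exists (q @^-1` `]-oo, 0[ `|` q @^-1` `]1, +oo[); split.
  - by apply: measurableU; apply: mG; exact: Gq.
  - by apply: null_set_setU => //; apply: mG; exact: Gq.
  - move=> w /= nq; rewrite !in_itv/= andbT.
    have [q0|q0] := ltP (q w) 0; first by left.
    have [q1|q1] := ltP 1 (q w); first by right.
    by exfalso; apply: nq; rewrite /q' trE// q0.
exists q'; split => // C GC; rewrite -[RHS](oq C GC).
have mC := mG C GC.
have mS f : P.-integrable setT f -> measurable_fun C f.
  by move=> /measurable_int; exact: measurable_funS.
apply: ae_eq_integral => //; [exact: mS id'|exact: mS id|].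
by apply: filterS qq' => w e _; rewrite e.
Qed.

(* [q] is a version of P(F | G). *)
Lemma cond_indep_events G (EE : set (set T)) F :
  (forall C, G C -> measurable C) -> (forall C, EE C -> measurable C) ->
  G setT -> EE setT -> measurable F ->
  (forall E, EE E -> exists p q r, [/\ cond_prob_version P G E p,
     cond_prob_version P G F q, cond_prob_version P G (E `&` F) r &
     {ae P, forall w, r w = p w * q w}]) ->
  exists q, [/\ forall B, measurable B -> G (q @^-1` B),
    forall w, `|q w| <= 1, orth P (fun w => 1 * \1_F w + -1 * q w) G &
    orth P (fun w => 1 * \1_F w + -1 * q w) EE].
Proof.
move=> mG mEE GT EET mF ci; have iF := integrable_indic_prob mF.
(* The full event only supplies a version of P(F | G) chosen before [E]; the version attached to
   each [E] may differ. *)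
have [_ [q [_ [_ vq _ _]]]] := ci _ EET.
have [q0 [Gq0 q01 _ oq0]] := cond_prob_truncate mG mF vq.
exists q0; split => //.
have meas (f : T -> R) : (forall B : set R, measurable B -> G (f @^-1` B)) -> measurable_fun setT f.
  by move=> Gf _ B mB; rewrite setTI; apply: mG; exact: Gf.
have mq0 := meas _ Gq0; have iq0 := bounded_integrable P mq0 q01.
have iD f : P.-integrable setT (EFin \o f) ->
    P.-integrable setT (EFin \o (fun w => 1 * \1_F w + -1 * f w)).
  exact: integrable_lincomb.
apply/orthP; [exact: iD|by []|] => E EE_E.
have mE := mEE E EE_E; have iE := integrable_indic_prob mE.
have [p1 [q1 [r [vp vq1 [Gr ir rE] rpq]]]] := ci E EE_E.
have [p [Gp p1' pe op]] := cond_prob_truncate mG mE vp.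
have [q2 [Gq2 q21 q2e oq2]] := cond_prob_truncate mG mF vq1.
have mp := meas _ Gp; have mq2 := meas _ Gq2.
have ip := bounded_integrable P mp p1'; have iq2 := bounded_integrable P mq2 q21.
have ipq2 := integrable_mul_bounded ip mq2 q21.
have iEq0 := integrable_mul_bounded iE mq0 q01.
have ipq0 := integrable_mul_bounded ip mq0 q01.
have prod_orth (D Y : T -> R) : P.-integrable setT (EFin \o D) -> orth P D G ->
    (forall B, measurable B -> G (Y @^-1` B)) -> (forall w, `|Y w| <= 1) ->
    \int[P]_w (D w * Y w) = 0.
  move=> i o GY Y1; apply: (orth_mul i mG o GY).
  exact: integrable_mul_bounded i (meas _ GY) Y1.
have EF : \int[P]_w (\1_E w * \1_F w) = \int[P]_w (p w * q2 w).
  transitivity (\int[P]_w r w).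
    rewrite /Rintegral rE// setIT -(setIT (E `&` F)).
    rewrite -integral_indic//; last exact: measurableI.
    by congr fine; apply: eq_integral => w _; rewrite indicI.
  congr fine; apply: ae_eq_integral => //.
  - exact: measurable_int ir.
  - exact: measurable_int ipq2.
  - apply: filterS3 rpq pe q2e => w e1 e2 e3 _ /=.
    by rewrite e1 e2 e3.
(* [Z1] says E[1_E q0] = E[p q0]; [Z2] says E[p q2] = E[p q0], as [q0] and [q2] are versions of the
   same conditional probability. With [EF], P(E and F) = E[p q2] = E[p q0] = E[1_E q0]. *)
have Z1 := prod_orth _ _ (integrable_lincomb 1 (-1) iE ip) op Gq0 q01.
have iq02 := integrable_lincomb 1 (-1) (iD _ iq0) (iD _ iq2).
have Z2 := prod_orth _ _ iq02 (orthD 1 (-1) (iD _ iq0) (iD _ iq2) mG oq0 oq2) Gp p1'.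
rewrite -Rintegral_indicM//.
have iEF : P.-integrable setT (EFin \o (fun w => \1_E w * \1_F w)).
  apply: (integrable_mul_bounded iE _ (M := 1)) => // w.
  by rewrite indicE ger0_norm// lern1 leq_b1.
transitivity (\int[P]_w (\1_E w * \1_F w - \1_E w * q0 w)).
  by apply: eq_Rintegral => w _; ring.
rewrite RintegralB// EF.
have -> : \int[P]_w (p w * q2 w) = \int[P]_w (p w * q0 w).
  apply/eqP; rewrite -subr_eq0 -RintegralB// -[X in _ == X]Z2; apply/eqP.
  by apply: eq_Rintegral => w _; ring.
apply/eqP; rewrite subr_eq0 eq_sym -subr_eq0 -RintegralB// -[X in _ == X]Z1; apply/eqP.
by apply: eq_Rintegral => w _; ring.
Qed.

End conditional_independence.

(** * Conditional independence in terms of covariances *)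

Section gaussian_cond_indep.
Local Open Scope classical_set_scope.
Context (R : realType) (d : measure_display) (T : measurableType d).
Context (P : probability T R) (n : nat) (V : 'I_n -> {RV P >-> R}).
Context (mu : 'rV[R]_n) (S : 'M[R]_n).
Hypothesis S_posdef : posdefmx S.
Hypothesis V_gaussian : gaussian_vector V mu S.
Implicit Types (l m : 'rV[R]_n).

Local Notation e := (delta_mx (0 : 'I_1)).
Local Notation centered := (centered V mu).
Local Notation cov := (cov S).

Lemma sigma_rv_sub (X Y : T -> R) (k : R -> R) : measurable_fun setT k ->
  (forall w, Y w = k (X w)) -> sigma_rv Y `<=` sigma_rv X.
Proof.
move=> mk YX _ [B mB <-]; exists (k @^-1` B).
  by rewrite -[X in measurable X]setTI; exact: mk.
by rewrite !setTI; apply/seteqP; split => w /=; rewrite YX.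
Qed.

Lemma sigma_rv_centered i : sigma_rv (centered (e i)) = sigma_rv (V i).
Proof.
apply/seteqP; split.
  apply: (@sigma_rv_sub _ _ (fun y => y - mu 0 i)); first exact: measurable_funB.
  by move=> w; rewrite centered_delta.
apply: (@sigma_rv_sub _ _ (fun y => y + mu 0 i)); first exact: measurable_funD.
by move=> w; rewrite centered_delta subrK.
Qed.

Lemma sigma_subvector_rv (I : {set 'I_n}) i : i \in I ->
  sigma_rv (V i) `<=` sigma_subvector V I.
Proof. by move=> iI C VC; apply: sub_sigma_algebra; exists i. Qed.

(** Preimages of Borel sets under one map already form a sigma-algebra. *)
Lemma sigma_subvector1 i : sigma_subvector V [set i]%SET = sigma_rv (V i).
Proof.
apply/seteqP; split; last by apply: sigma_subvector_rv; rewrite inE.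
apply: smallest_sub.
  by apply: sigma_algebra_preimage; exact: sigma_algebra_measurable.
by move=> C [j /=]; rewrite inE => /eqP ->.
Qed.

Lemma gaussian_null l : l != 0 -> P (centered l @^-1` [set 0]) = 0%E.
Proof.
move=> l0; rewrite -[RHS](normal_prob_set1 (\sum_(i < n) l 0 i * mu 0 i)
  (Num.sqrt (cov l l)) (\sum_(i < n) l 0 i * mu 0 i)).
rewrite -V_gaussian//; congr (P _).
have cE w : centered l w =
    \sum_(i < n) l 0 i * V i w - \sum_(i < n) l 0 i * mu 0 i.
  by rewrite -sumrB; apply: eq_bigr => i _; rewrite mulrBr.
apply/seteqP; split => w /=; rewrite cE.
  by move=> /eqP; rewrite subr_eq0 => /eqP.
by move=> ->; rewrite subrr.
Qed.

(** Zero integrals over the events where [centered l] is positive, respectively negative, make both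
    null. For nonzero [l] its zero set is null too, because a normal law has no atoms, and the whole
    space would have probability 0. *)
Lemma orth_self_eq0 l : orth P (centered l) (sigma_rv (centered l)) -> l = 0.
Proof.
move=> o; apply/eqP; apply: contrapT => /negP l0.
have il := integrable_centered S_posdef V_gaussian l.
have ml := measurable_centered V mu l.
have mpre (B : set R) : measurable B -> measurable (centered l @^-1` B).
  by move=> mB; rewrite -[X in measurable X]setTI; exact: ml.
have pos0 : P (centered l @^-1` `]0, +oo[) = 0%E.
  apply: (integral_eq0_null _ il); first exact: mpre.
    by move=> w /=; rewrite in_itv/= andbT.
  by apply: o; exact: sigma_rv_preimage.
have neg0 : P (centered l @^-1` `]-oo, 0[) = 0%E.
  have oN := orthD (-1) 0 il il (sigma_rv_measurable ml) o o.
  apply: (integral_eq0_null _ (integrable_lincomb (-1) 0 il il)).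
  - exact: mpre.
  - by move=> w /=; rewrite in_itv/=; lra.
  - by apply: oN; exact: sigma_rv_preimage.
have := @probability_setT _ _ _ P.
rewrite (_ : setT = (centered l @^-1` `]0, +oo[ `|` centered l @^-1` `]-oo, 0[)
    `|` centered l @^-1` [set 0]); last first.
  apply/seteqP; split => // w _ /=; rewrite !in_itv/= andbT.
  by have [|| <-] := ltgtP 0 (centered l w); [left; left|left; right|right].
rewrite null_set_setU//; [|by apply: measurableU; exact: mpre|exact: mpre| |].
- by move=> /eqP; rewrite eq_sym onee_eq0.
- by apply: null_set_setU => //; exact: mpre.
- exact: gaussian_null.
Qed.

Lemma cond_indep_cov (I J : {set 'I_n}) (u v x : 'I_n) : u \in I -> v \in J ->
  cond_indep V I J [set x]%SET -> S u v = S u x * S v x / S x x.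
Proof.
move=> uI vJ ci.
have e0 i : e i != 0 :> 'rV[R]_n.
  apply/eqP => /matrixP /(_ 0 i) /eqP; rewrite !mxE !eqxx/=.
  by rewrite oner_eq0.
have Sgt0 i : 0 < S i i by rewrite -cov_delta cov_gt0.
(* The residual of component [u] after regression on [x]; below, [k] is the residual of [l] after
   regression on [v]. *)
pose l := 1 *: e u + (- (S u x / S x x)) *: e x.
have lx0 : cov l (e x) = 0.
  by rewrite covDl !cov_delta; field; rewrite gt_eqF.
pose k := 1 *: l + (- (cov l (e v) / S v v)) *: e v.
have kv0 : cov k (e v) = 0.
  by rewrite covDl !cov_delta; field; rewrite gt_eqF.
have ic m := integrable_centered S_posdef V_gaussian m.
have ol : orth P (centered l) (sigma_rv (V x)).
  by rewrite -sigma_rv_centered; exact: (centered_orth S_posdef V_gaussian lx0).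
have ok : orth P (centered k) (sigma_rv (V v)).
  by rewrite -sigma_rv_centered; exact: (centered_orth S_posdef V_gaussian kv0).
have mV i C : sigma_rv (V i) C -> measurable C by exact: sigma_rv_measurable.
have rvT i : sigma_rv (V i) setT.
  by rewrite -(preimage_setT (V i)); exact: sigma_rv_preimage.
have cV i (B : set R) : measurable B -> sigma_rv (V i) (centered (e i) @^-1` B).
  by rewrite -sigma_rv_centered; exact: sigma_rv_preimage.
have olv : orth P (centered l) (sigma_rv (V v)).
  apply/orthP => // [|F VF]; first exact: mV.
  have mF := mV _ _ VF.
  have [|q [Vq q1 ox ou]] := @cond_indep_events _ _ _ P (sigma_rv (V x))
      (sigma_rv (V u)) F (mV x) (mV u) (rvT x) (rvT u) mF.
    move=> E VE; have := ci E F (sigma_subvector_rv uI VE) (sigma_subvector_rv vJ VF).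
    by rewrite sigma_subvector1.
  have mq : measurable_fun setT q.
    by move=> _ B mB; rewrite setTI; apply: (mV x); exact: Vq.
  pose D w := 1 * \1_F w + -1 * q w.
  have iF := integrable_indic_prob P mF.
  have iq := bounded_integrable P mq q1.
  have iD : P.-integrable setT (EFin \o D) by exact: integrable_lincomb.
  have indic1 w : `|\1_F w : R| <= 1.
    by rewrite indicE ger0_norm// lern1 leq_b1.
  have D2 w : `|D w| <= 2.
    rewrite /D mul1r mulN1r; apply: le_trans (ler_normB _ _) _.
    by have := indic1 w; have := q1 w; lra.
  have mD := integrable_measurable iD.
  have iDc m := integrable_mul_bounded (ic m) mD D2.
  have Dc i : orth P D (sigma_rv (V i)) -> \int[P]_w (centered (e i) w * D w) = 0.
    move=> o; under eq_Rintegral do rewrite mulrC.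
    apply: (orth_mul iD (mV i) o (cV i)).
    have := iDc (e i); congr (P.-integrable _ _).
    by apply/funext => w /=; rewrite mulrC.
  (* [l] combines components [u] and [x], and [D] is orthogonal to the sigma-algebra of each ([ou]
     and [ox]). *)
  have Dl : \int[P]_w (centered l w * D w) = 0.
    transitivity (\int[P]_w (1 * (centered (e u) w * D w) +
        - (S u x / S x x) * (centered (e x) w * D w))).
      by apply: eq_Rintegral => w _; rewrite centeredD; ring.
    rewrite RintegralD//; first by rewrite !RintegralZl// !Dc// !mulr0 addr0.
      exact: (integrableZl measurableT 1 (iDc (e u))).
    exact: (integrableZl measurableT _ (iDc (e x))).
  (* Here the roles are exchanged: [q] is measurable for component [x], to which [l] is
     orthogonal. *)
  have lq : \int[P]_w (centered l w * q w) = 0.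
    apply: (orth_mul (ic l) (mV x) ol Vq).
    exact: integrable_mul_bounded (ic l) mq q1.
  rewrite -Rintegral_indicM//.
  transitivity (\int[P]_w (centered l w * D w + centered l w * q w)).
    by apply: eq_Rintegral => w _; rewrite /D; ring.
  rewrite RintegralD//; first by rewrite Dl lq addr0.
  exact: integrable_mul_bounded (ic l) mq q1.
have [lv0|lv0] := eqVneq (cov l (e v)) 0.
  move: lv0; rewrite covDl !cov_delta => /eqP.
  rewrite mul1r mulNr subr_eq0 => /eqP ->.
  by rewrite -[S x v]cov_delta covC// cov_delta; ring.
exfalso; move: (e0 v); apply/negP; rewrite negbK; apply/eqP.
apply: orth_self_eq0; rewrite sigma_rv_centered.
(* Since l - k = c e_v, a nonzero [c] would make the centered component [v] orthogonal to its own
   sigma-algebra. *)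
pose c := cov l (e v) / S v v.
have c0 : c != 0 by rewrite mulf_neq0// invr_neq0// gt_eqF.
have := orthD c^-1 (- c^-1) (ic l) (ic k) (mV v) olv ok.
congr (orth _ _ _); apply/funext => w.
by rewrite [centered k w]centeredD -/c; field.
Qed.

End gaussian_cond_indep.

(** * Partial covariances given at most one component *)

Section partial_correlation.
Context (R : realType) (n : nat) (S : 'M[R]_n).
Implicit Types (u v z : 'I_n).

Lemma partial_cov_set0 u v : partial_cov S u v finset.set0 = S u v.
Proof.
rewrite /partial_cov; set e := enum_val; move: e.
rewrite cards0 => e.
by rewrite !mxE big_ord0 subr0.
Qed.

Lemma partial_cov_set1 u v z :
  partial_cov S u v [set z]%SET = S u v - S u z * S z v / S z z.
Proof.
have ez (i : 'I_#|[set z]%SET|) : enum_val i = z.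
  by have := enum_valP i; rewrite inE => /eqP.
(* The enumeration is generalized so that the cardinal in its type can be rewritten to 1. *)
rewrite /partial_cov; move: enum_val ez; rewrite cards1 => e ez.
have -> : mxsub e e S = (S z z)%:M.
  by apply/matrixP => i j; rewrite !mxE !ez !ord1 eqxx mulr1n.
rewrite invmx_scalar scalar_mxC mul_scalar_mx -scalemxAl !mxE big_ord1 !mxE !ez.
by congr (_ - _); rewrite mulrC.
Qed.

End partial_correlation.

(** * Two-by-two minors of a positive definite matrix *)

Section posdef.
Context (R : realType) (n : nat) (S : 'M[R]_n).
Hypothesis S_posdef : posdefmx S.

Lemma posdef_sym u v : S u v = S v u.
Proof. by have [sS _] := S_posdef; rewrite -[in LHS]sS mxE. Qed.

Lemma posdef_diag_gt0 u : 0 < S u u.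
Proof.
rewrite -cov_delta cov_gt0//; apply/eqP => /matrixP /(_ 0 u) /eqP.
by rewrite !mxE !eqxx/= oner_eq0.
Qed.

Lemma posdef_minor_gt0 u v : u != v -> S u v ^+ 2 < S u u * S v v.
Proof.
move=> uv; have vv := posdef_diag_gt0 v.
(* The quadratic form takes at [t] the value S_vv times the minor; u != v keeps the coordinate S_vv
   of [t] intact. *)
pose t : 'rV[R]_n := S v v *: delta_mx 0 u + (- S u v) *: delta_mx 0 v.
have t0 : t != 0.
  apply/eqP => /matrixP /(_ 0 u) /eqP.
  rewrite !mxE !eqxx/= (negbTE uv)/= mulr1 mulr0 addr0.
  by rewrite gt_eqF.
have := cov_gt0 S_posdef t0.
rewrite covDl !covDr// !cov_delta (posdef_sym v u).
have -> : S v v * (S v v * S u u + - S u v * S u v) +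
  - S u v * (S v v * S u v + - S u v * S v v) =
  S v v * (S u u * S v v - S u v ^+ 2) by ring.
by rewrite pmulr_rgt0// subr_gt0.
Qed.

Lemma posdef_minor_ge0 u v : S u v ^+ 2 <= S u u * S v v.
Proof.
have [->|/posdef_minor_gt0/ltW//] := eqVneq u v.
by rewrite expr2.
Qed.

End posdef.

(** * The factor by which conditioning shrinks the squared correlation *)

Section attenuation.
Context (R : realFieldType).
Implicit Types (al ga ze : R).

(** The factor relating rho^2_(ac|z) to rho^2_ac; [al], [ga] and [ze] stand for the squared
    correlations of a, c and z with x. *)
Definition attenuation al ga ze :=
  (1 - ze) ^+ 2 / ((1 - al * ze) * (1 - ga * ze)).

(** The factor splits into two nonnegative quotients (1 - ze) / (1 - b ze), b = al or ga. Each is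
    nonincreasing in [ze]: cross-multiplying leaves (1 - b) (ze - ze'). *)
Lemma attenuation_le al ga ze ze' : al <= 1 -> ga <= 1 ->
  al * ze < 1 -> ga * ze < 1 -> al * ze' < 1 -> ga * ze' < 1 ->
  ze' <= ze -> ze <= 1 ->
  attenuation al ga ze <= attenuation al ga ze'.
Proof.
move=> al1 ga1 az gz az' gz' zz z1.
have one b : b <= 1 -> b * ze < 1 -> b * ze' < 1 ->
    0 <= (1 - ze) / (1 - b * ze) <= (1 - ze') / (1 - b * ze').
  move=> b1 bz bz'; rewrite divr_ge0/=; [|lra|lra].
  rewrite ler_pdivrMr ?subr_gt0// mulrAC ler_pdivlMr ?subr_gt0//.
  rewrite -subr_ge0.
  have -> : (1 - ze') * (1 - b * ze) - (1 - ze) * (1 - b * ze') =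
    (1 - b) * (ze - ze') by ring.
  by rewrite mulr_ge0//; lra.
have sp z : attenuation al ga z = (1 - z) / (1 - al * z) * ((1 - z) / (1 - ga * z)).
  by rewrite /attenuation mulf_div expr2.
have /andP[p1 q1] := one al al1 az az'.
have /andP[p2 q2] := one ga ga1 gz gz'.
by rewrite !sp ler_pM.
Qed.

Lemma attenuation0 al ga : attenuation al ga 0 = 1.
Proof. by rewrite /attenuation !mulr0 !subr0 mulr1 expr1n divr1. Qed.

End attenuation.

(** * Squared partial correlations when x separates a from c *)

Section markov.
Context (R : realType) (n : nat) (S : 'M[R]_n).
Hypothesis S_posdef : posdefmx S.
Context (a c x : 'I_n).
Hypothesis ac : S a c = S a x * S c x / S x x.

Let al := S a x ^+ 2 / (S a a * S x x).
Let ga := S c x ^+ 2 / (S c c * S x x).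

Let pd := posdef_diag_gt0 S_posdef.

Lemma sq_ratio_ge0 (r : R) u w : 0 <= r ^+ 2 / (S u u * S w w).
Proof. by rewrite divr_ge0 ?sqr_ge0// mulr_ge0// ltW. Qed.

Lemma sq_partial_corr_set0 :
  sq_partial_corr S a c finset.set0 = S a c ^+ 2 / (S a a * S c c).
Proof. by rewrite /sq_partial_corr !partial_cov_set0. Qed.

(** The common coefficient [t] is a parameter so as to cover both uses: for z it is the regression
    coefficient on x, for z' a product of two regression coefficients through z. *)
Lemma sq_partial_corr_set1 w t : S a w = S a x * t -> S c w = S c x * t ->
  sq_partial_corr S a c [set w]%SET =
  S a c ^+ 2 / (S a a * S c c) * attenuation al ga (t ^+ 2 * S x x / S w w).
Proof.
move=> aw cw; rewrite /sq_partial_corr !partial_cov_set1 /attenuation.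
rewrite !(posdef_sym S_posdef w) aw cw.
have nz i : S i i != 0 by rewrite gt_eqF.
have -> : S a c - S a x * t * (S c x * t) / S w w =
    S a c * (1 - t ^+ 2 * S x x / S w w).
  by rewrite ac; field; rewrite !nz.
have -> : S a a - S a x * t * (S a x * t) / S w w =
    S a a * (1 - al * (t ^+ 2 * S x x / S w w)).
  by rewrite /al; field; rewrite !nz.
have -> : S c c - S c x * t * (S c x * t) / S w w =
    S c c * (1 - ga * (t ^+ 2 * S x x / S w w)).
  by rewrite /ga; field; rewrite !nz.
by rewrite exprMn [X in _ / X]mulrACA -[LHS]mulf_div.
Qed.

Lemma sq_corr_le1 u : S u x ^+ 2 / (S u u * S x x) <= 1.
Proof. by rewrite ler_pdivrMr ?mulr_gt0// mul1r posdef_minor_ge0. Qed.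

(** The product collapses to rho^2_uw, which is below 1 for distinct components. *)
Lemma sq_corr_mul_lt1 u w t : u != w -> S u w = S u x * t ->
  S u x ^+ 2 / (S u u * S x x) * (t ^+ 2 * S x x / S w w) < 1.
Proof.
move=> uw e; have nz i : S i i != 0 by rewrite gt_eqF.
have -> : S u x ^+ 2 / (S u u * S x x) * (t ^+ 2 * S x x / S w w) =
    S u w ^+ 2 / (S u u * S w w) by rewrite e; field; rewrite !nz.
by rewrite ltr_pdivrMr ?mulr_gt0// mul1r posdef_minor_gt0.
Qed.

Lemma sq_partial_corr_le w w' t t' : a != w -> c != w -> a != w' -> c != w' ->
  S a w = S a x * t -> S c w = S c x * t ->
  S a w' = S a x * t' -> S c w' = S c x * t' ->
  t' ^+ 2 * S x x / S w' w' <= t ^+ 2 * S x x / S w w <= 1 ->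
  sq_partial_corr S a c [set w]%SET <= sq_partial_corr S a c [set w']%SET.
Proof.
move=> naw ncw naw' ncw' aw cw aw' cw' /andP[le1 le2].
rewrite (sq_partial_corr_set1 aw cw) (sq_partial_corr_set1 aw' cw').
rewrite ler_wpM2l ?sq_ratio_ge0//.
by apply: attenuation_le; rewrite ?sq_corr_le1 ?sq_corr_mul_lt1.
Qed.

Lemma sq_partial_corr_le_corr w t : a != w -> c != w ->
  S a w = S a x * t -> S c w = S c x * t -> t ^+ 2 * S x x / S w w <= 1 ->
  sq_partial_corr S a c [set w]%SET <= sq_partial_corr S a c finset.set0.
Proof.
move=> naw ncw aw cw le1.
rewrite (sq_partial_corr_set1 aw cw) sq_partial_corr_set0 -[leRHS]mulr1.
rewrite ler_wpM2l ?sq_ratio_ge0//.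
rewrite -(attenuation0 al ga); apply: attenuation_le;
  rewrite ?sq_corr_le1 ?sq_corr_mul_lt1 ?mulr0 ?ltr01//.
exact: divr_ge0 (mulr_ge0 (sqr_ge0 _) (ltW (pd _))) (ltW (pd _)).
Qed.

End markov.

(** * From conditional independence to the inequalities *)

Theorem theorem2 (R : realType) (d : measure_display) (T : measurableType d)
    (P : probability T R) (n : nat) (V : 'I_n -> {RV P >-> R})
    (mu : 'rV[R]_n) (S : 'M[R]_n) (a c z x : 'I_n)
    (S_posdef : posdefmx S)
    (V_gaussian : gaussian_vector V mu S)
    (a_neq_c : a <> c)
    (z_notin_ac : z \notin [set a; c]%SET)
    (ac_indep_x : cond_indep V [set a]%SET [set c]%SET [set x]%SET)
    (acz_indep_x : cond_indep V [set a; c]%SET [set z]%SET [set x]%SET) :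
  sq_partial_corr S a c [set z]%SET <= sq_partial_corr S a c finset.set0 /\
  (forall z' : 'I_n,
     z' \notin [set a; c]%SET ->
     cond_indep V [set a; c]%SET [set z']%SET [set z]%SET ->
     sq_partial_corr S a c [set z]%SET <= sq_partial_corr S a c [set z']%SET /\
     sq_partial_corr S a c [set z']%SET <= sq_partial_corr S a c finset.set0).
Proof.
have pd := posdef_diag_gt0 S_posdef.
have nz i : S i i != 0 by rewrite gt_eqF.
have split_notin w : w \notin [set a; c]%SET -> a != w /\ c != w.
  by rewrite !inE negb_or ![w == _]eq_sym => /andP[].
have [az cz] := split_notin z z_notin_ac.
have cic := cond_indep_cov S_posdef V_gaussian.
have ac : S a c = S a x * S c x / S x x by apply: (cic _ _ _ _ _ _ _ ac_indep_x); rewrite !inE.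
pose t := S z x / S x x.
have Saz : S a z = S a x * t.
  by rewrite mulrA; apply: (cic _ _ _ _ _ _ _ acz_indep_x); rewrite !inE eqxx.
have Scz : S c z = S c x * t.
  by rewrite mulrA; apply: (cic _ _ _ _ _ _ _ acz_indep_x); rewrite !inE eqxx ?orbT.
have tE : t ^+ 2 * S x x / S z z = S z x ^+ 2 / (S z z * S x x).
  by rewrite /t; field; rewrite !nz.
have z1 : t ^+ 2 * S x x / S z z <= 1 by rewrite tE sq_corr_le1.
(* From here [t] enters only through [Saz], [Scz] and the bound [z1]. *)
clearbody t => {tE}.
split; first exact: (sq_partial_corr_le_corr S_posdef ac az cz Saz Scz).
move=> z' z'_notin ci'; have [az' cz'] := split_notin z' z'_notin.
(* Regression coefficients multiply along x, z, z', because z separates z' from a and c. *)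
pose t' := t * (S z' z / S z z).
have Saz' : S a z' = S a x * t'.
  rewrite /t' mulrA -Saz mulrA.
  by apply: (cic _ _ _ _ _ _ _ ci'); rewrite !inE eqxx.
have Scz' : S c z' = S c x * t'.
  rewrite /t' mulrA -Scz mulrA.
  by apply: (cic _ _ _ _ _ _ _ ci'); rewrite !inE eqxx ?orbT.
have zz' : t' ^+ 2 * S x x / S z' z' <= t ^+ 2 * S x x / S z z.
  (* The extra factor is rho^2_zz', at most 1. *)
  have -> : t' ^+ 2 * S x x / S z' z' =
      t ^+ 2 * S x x / S z z * (S z' z ^+ 2 / (S z' z' * S z z)).
    by rewrite /t'; field; rewrite !nz.
  rewrite ler_piMr ?sq_corr_le1//.
  exact: divr_ge0 (mulr_ge0 (sqr_ge0 _) (ltW (pd _))) (ltW (pd _)).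
split; first by apply: (sq_partial_corr_le S_posdef ac _ _ _ _ Saz Scz Saz' Scz'); rewrite ?zz'.
exact: (sq_partial_corr_le_corr S_posdef ac az' cz' Saz' Scz' (le_trans zz' z1)).
Qed.
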